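(* (i) If $G$ is a partial cube and $G'$ is an expansion of $G$, then $G'$ is a partial cube. (ii) If $G'$ is a partial cube and $G$ is a contraction of $G'$, then $G$ is a partial cube.
   Context: Graphs are simple, undirected, nonempty, and not necessarily finite. For a set $X$, the hypercube $\mathcal H(X)$ is the graph whose vertices are the finite subsets of $X$, with $P,Q$ adjacent iff $|P\Delta Q|=1$. A graph is a partial cube if it can be isometrically embedded (i.e. by a map preserving shortest-path distances) into some $\mathcal H(X)$. A subgraph $H$ of a connected graph $G$ is isometric if $d_H(a,b)=d_G(a,b)$ for all vertices $a,b$ of $H$. Expansion: let $G=(V,E)$ be a connected graph and let $G_1=(V_1,E_1)$, $G_2=(V_2,E_2)$ be two (nonempty) isometric subgraphs of $G$ with $G=G_1\cup G_2$ (i.e. $V=V_1\cup V_2$, $E=E_1\cup E_2$). The expansion of $G$ with respect to $G_1$ and $G_2$ is the graph $G'$ with vertex set $V'_1\cup V'_2$, where $V'_i=\{x^i=(i,x):x\in V_i\}$, whose edges are $x^iy^i$ for $xy\in E_i$ ($i=1,2$) together with the edges $x^1x^2$ for $x\in V_1\cap V_2$. In this case $G$ is called a contraction of $G'$ (expansions and contractions are taken up to isomorphism). *)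

(* Defs.v *)
From mathcomp Require Import all_boot.
From mathcomp Require Import boolp classical_sets functions cardinality.

Set Implicit Arguments.
Unset Strict Implicit.
Unset Printing Implicit Defensive.

Local Open Scope classical_set_scope.
Local Open Scope card_scope.

(* The vertex type is arbitrary, possibly infinite. The adjacency relation is
   boolean to match the library's [rel]; arbitrary relations are embedded
   through [asbool]. *)
Record sgraph := SGraph {
  vertex :> Type;
  adj : rel vertex;
  adj_sym : symmetric adj;
  adj_irr : irreflexive adj;
  vertex_inhabited : inhabited vertex }.

Definition walk (G : sgraph) (x y : G) (n : nat) : Prop :=
  exists p : seq G, [/\ path (@adj G) x p, last x p = y & size p = n].

Lemma ex_walkb (G : sgraph) (x y : G) :
  (exists n, walk x y n) -> exists n, `[< walk x y n >].
Proof. by move=> [n w]; exists n; apply/asboolP. Qed.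

(* [None] stands for an infinite distance. *)
Definition gdist (G : sgraph) (x y : G) : option nat :=
  if pselect (exists n, walk x y n) is left e then Some (ex_minn (ex_walkb e))
  else None.

Definition connected_graph (G : sgraph) : Prop :=
  forall x y : G, exists n, walk x y n.

Definition isometric_embedding (G H : sgraph) (f : G -> H) : Prop :=
  forall x y : G, gdist (f x) (f y) = gdist x y.

Definition graph_iso (G H : sgraph) : Prop :=
  exists2 f : G -> H, bijective f & forall x y, adj (f x) (f y) = adj x y.

Section Hypercube.
Variable X : Type.

Definition hc_vertex := {P : set X | finite_set P}.

Definition hc_adj : rel hc_vertex :=
  fun P Q => sval P `+` sval Q #= `I_1.

Lemma hc_adj_sym : symmetric hc_adj.
Proof. by move=> P Q; rewrite /hc_adj setYC. Qed.

Lemma hc_adj_irr : irreflexive hc_adj.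
Proof.
move=> P; rewrite /hc_adj setYK; apply/negP.
by rewrite card_eq_sym card_eq0 => /eqP/seteqP[/(_ 0%N erefl)].
Qed.

Lemma hc_inhabited : inhabited hc_vertex.
Proof. by constructor; exists set0; exact: finite_set0. Qed.

Definition hypercube : sgraph := SGraph hc_adj_sym hc_adj_irr hc_inhabited.

End Hypercube.

Definition partial_cube (G : sgraph) : Prop :=
  exists (X : Type) (f : G -> hypercube X), isometric_embedding f.

Record subgraph (G : sgraph) := Subgraph {
  sg_vertex : set G;
  sg_edge : rel G;
  sg_edge_sym : symmetric sg_edge;
  sg_edge_adj : forall x y, sg_edge x y -> adj x y;
  sg_edge_vertex : forall x y, sg_edge x y -> sg_vertex x /\ sg_vertex y;
  sg_nonempty : sg_vertex !=set0 }.

Section SubgraphAsGraph.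
Variables (G : sgraph) (H : subgraph G).

Definition sub_vertex := {x : G | sg_vertex H x}.

Definition sub_adj : rel sub_vertex := fun x y => sg_edge H (sval x) (sval y).

Lemma sub_adj_sym : symmetric sub_adj.
Proof. by move=> x y; exact: sg_edge_sym. Qed.

Lemma sub_adj_irr : irreflexive sub_adj.
Proof. by move=> x; apply/negP => /sg_edge_adj; rewrite adj_irr. Qed.

Lemma sub_inhabited : inhabited sub_vertex.
Proof. by have [x Hx] := sg_nonempty H; constructor; exists x. Qed.

Definition sub_graph : sgraph := SGraph sub_adj_sym sub_adj_irr sub_inhabited.

Definition isometric_subgraph : Prop :=
  forall a b : sub_graph, gdist a b = gdist (sval a) (sval b).

End SubgraphAsGraph.

Definition subgraph_cover (G : sgraph) (G1 G2 : subgraph G) : Prop :=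
  (forall x, sg_vertex G1 x \/ sg_vertex G2 x) /\
  (forall x y, adj x y = sg_edge G1 x y || sg_edge G2 x y).

Section Expansion.
Variables (G : sgraph) (G1 G2 : subgraph G).

(* [inl x] is x^1 and [inr x] is x^2. *)
Definition exp_vertex := (sub_graph G1 + sub_graph G2)%type.

Definition exp_adj : rel exp_vertex := fun u v =>
  match u, v with
  | inl x, inl y => adj x y
  | inr x, inr y => adj x y
  | inl x, inr y => `[< sval x = sval y >]
  | inr x, inl y => `[< sval x = sval y >]
  end.

Lemma exp_adj_sym : symmetric exp_adj.
Proof.
by move=> [x|x] [y|y] /=; [exact: sub_adj_sym | | | exact: sub_adj_sym];
  apply/asboolP/asboolP => ->.
Qed.

Lemma exp_adj_irr : irreflexive exp_adj.
Proof. by move=> [x|x] /=; exact: sub_adj_irr. Qed.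

Lemma exp_inhabited : inhabited exp_vertex.
Proof. by have [x] := vertex_inhabited (sub_graph G1); constructor; left. Qed.

Definition expansion : sgraph := SGraph exp_adj_sym exp_adj_irr exp_inhabited.

End Expansion.

Definition is_expansion (G' G : sgraph) : Prop :=
  connected_graph G /\
  exists G1 G2 : subgraph G,
    [/\ isometric_subgraph G1, isometric_subgraph G2, subgraph_cover G1 G2
      & graph_iso G' (expansion G1 G2)].

Definition is_contraction (G G' : sgraph) : Prop := is_expansion G' G.

(* Main.v *)
(** Everything is controlled by the identity [d(x^i, y^j) = d(x, y) + [i != j]]
    in an expansion: projecting a walk to [G] erases its switches of side, and
    a geodesic of [G] from [V1] to [V2] meets [V1 `&` V2], where it can be cut
    into two pieces that the isometric subgraphs realise. For (i), label [x^i]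
    by the label of [x], plus one new element on the second side. For (ii), fix
    [z] in [V1 `&` V2]; the labels of [z^1] and [z^2] differ by a single [e],
    the identity shows that [e] separates the labels of [x^i] and [y^j] exactly
    when [i != j], and deleting [e] from the labels gives an embedding of [G]. *)
From mathcomp Require Import all_boot.
From mathcomp Require Import boolp classical_sets functions cardinality.
Require Import Defs.

Set Implicit Arguments.
Unset Strict Implicit.
Unset Printing Implicit Defensive.

Local Open Scope classical_set_scope.
Local Open Scope card_scope.

Lemma addb_iffP (a b : bool) : ~ (a <-> b) <-> a (+) b.
Proof.
case: a b => [] [] /=; split=> //.
- by case.
- by move=> _ [/(_ isT)].
- by move=> _ [_ /(_ isT)].
- by case.
Qed.

(** * Symmetric differences and cardinals of finite sets *)

Section Cardinals.
Context {T : Type}.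
Implicit Types (A B C : set T) (x : T).

Lemma setYP A B x : (A `+` B) x <-> ~ (A x <-> B x).
Proof.
rewrite setY_def /setU /setD /=.
by case: (pselect (A x)) => ?; case: (pselect (B x)) => ?; tauto.
Qed.

Lemma setY_cancel A B C : (A `+` C) `+` (B `+` C) = A `+` B.
Proof. by rewrite (setYC B) setYA -(setYA A) setYK setY0. Qed.

Lemma setY1_in A x : A x -> A `+` [set x] = A `\ x.
Proof.
move=> Ax; apply/seteqP; split=> y; rewrite setYP /setD /=.
  move=> h; case: (pselect (A y)) => Ay; first by tauto.
  by case: (pselect (y = x)) => [yx|?]; [subst | tauto].
by tauto.
Qed.

Lemma finite_setY A B : finite_set A -> finite_set B -> finite_set (A `+` B).
Proof. by move=> *; rewrite setY_def finite_setU; split; exact: finite_setD. Qed.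

Lemma card_II_inj A n m : A #= `I_n -> A #= `I_m -> n = m.
Proof.
by move=> An Am; apply/card_eq_II/(card_eq_trans _ Am); rewrite card_eq_sym.
Qed.

(** [eq_cardSP] provides some point whose removal lowers the cardinal by one; comparing cardinals
    shows that any point of [A] does. *)
Lemma card_eqS_setD1 A x n : A x -> (A #= `I_n.+1) = (A `\ x #= `I_n).
Proof.
move=> Ax; apply/idP/idP => [An|An]; last by apply/eq_cardSP; exists x.
have /finite_setP[m Dm] : finite_set (A `\ x).
  by apply: finite_setD; apply/finite_setP; exists n.+1.
have Am : A #= `I_m.+1 by apply/eq_cardSP; exists x.
by have [->] := card_II_inj An Am.
Qed.

Lemma card_eq1P A : A #= `I_1 -> exists x, A = [set x].
Proof.
move=> /eq_cardSP[x Ax]; rewrite II0 card_eq0 => /eqP D0; exists x.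
apply/seteqP; split=> [y Ay|_ ->//].
apply: contrapT => yx; suff : (A `\ x) y by rewrite D0.
by split.
Qed.

(** If [x] were in [A], toggling it would shrink [A]. This is how distances will reveal that two
    labels agree at a given element. *)
Lemma card_setY1_notin A x n :
  A #= `I_n -> A `+` [set x] #= `I_n.+1 -> ~ A x.
Proof.
move=> An As Ax; move: As; rewrite setY1_in// => As.
have: A #= `I_n.+2 by rewrite (card_eqS_setD1 _ Ax).
by move=> /(card_II_inj An)/eqP; rewrite eqn_leq ltnNge leqnSn andbF.
Qed.

End Cardinals.

(** * Walks and distances *)

Section Walks.
Implicit Types G H : sgraph.

Lemma walk0 G (x : G) : walk x x 0.
Proof. by exists [::]. Qed.

Lemma walk0_eq G (x y : G) : walk x y 0 -> x = y.
Proof. by move=> [[|z p] []]. Qed.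

Lemma walkS G (x z : G) n :
  walk x z n.+1 <-> exists2 y, adj x y & walk y z n.
Proof.
split=> [[[|y p] []//= /andP[xy yp] yz [pn]]|[y xy [p [yp yz pn]]]].
  by exists y => //; exists p.
by exists (y :: p); split=> //=; rewrite ?xy ?pn.
Qed.

Lemma walk1 G (x y : G) : adj x y -> walk x y 1.
Proof. by move=> xy; apply/walkS; exists y => //; exact: walk0. Qed.

Lemma walk_cat G (x y z : G) m n :
  walk x y m -> walk y z n -> walk x z (m + n).
Proof.
elim: m x => [|m IH] x; first by move=> /walk0_eq ->.
move=> /walkS[x' xx' x'y] yz; rewrite addSn; apply/walkS.
by exists x' => //; exact: IH.
Qed.

Lemma walk_sym G (x y : G) n : walk x y n -> walk y x n.
Proof.
elim: n x => [|n IH] x; first by move=> /walk0_eq ->; exact: walk0.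
move=> /walkS[z xz /IH yz]; rewrite -addn1; apply: walk_cat yz _.
by apply: walk1; rewrite adj_sym.
Qed.

Lemma walk_homo G H (f : G -> H) :
  (forall x y, adj x y -> adj (f x) (f y)) ->
  forall x y n, walk x y n -> walk (f x) (f y) n.
Proof.
move=> fadj x y n; elim: n x => [|n IH] x.
  by move=> /walk0_eq ->; exact: walk0.
move=> /walkS[z xz /IH zy]; apply/walkS; exists (f z) => //.
exact: fadj.
Qed.

Lemma gdistP G (x y : G) n :
  gdist x y = Some n <-> walk x y n /\ forall m, walk x y m -> n <= m.
Proof.
rewrite /gdist; case: pselect => [e|ne]; last first.
  by split=> // -[xy _]; case: ne; exists n.
case: ex_minnP => k /asboolP xyk kmin; split.
  move=> [<-]; split=> // m xym; apply: kmin; exact/asboolP.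
move=> [xyn nmin]; congr Some; apply/eqP; rewrite eqn_leq nmin// andbT.
exact/kmin/asboolP.
Qed.

Lemma gdist_walk G (x y : G) n :
  walk x y n -> exists2 m, gdist x y = Some m & m <= n.
Proof.
move=> xyn; have [k /asboolP xyk kmin] :=
  ex_minnP (ex_walkb (ex_intro _ n xyn)).
exists k; last exact/kmin/asboolP.
by apply/gdistP; split=> // m xym; exact/kmin/asboolP.
Qed.

Lemma connected_gdist G (x y : G) :
  connected_graph G -> exists n, gdist x y = Some n.
Proof. by move=> /(_ x y)[n /gdist_walk[m]]; exists m. Qed.

(** Infinite distances are covered too: they mean that no length occurs, on either side. *)
Lemma eq_gdist G H (x y : G) (x' y' : H) :
  (forall n, walk x y n <-> walk x' y' n) -> gdist x y = gdist x' y'.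
Proof.
move=> e; case E: (gdist x y) => [n|].
  apply/esym/gdistP; have /gdistP[xyn nmin] := E.
  by split=> [|m /e]; [exact/e | exact: nmin].
case E': (gdist x' y') => [n|//].
have /gdistP[/e /gdist_walk[m]] := E'.
by rewrite E.
Qed.

End Walks.

(** * Hypercube distances and labellings by sets *)

Section Labellings.
Implicit Types G H : sgraph.

(** Each step toggles one element, so it changes the cardinal of the symmetric difference by exactly
    one, up or down. *)
Lemma hypercube_walk X (P Q : hypercube X) n :
  walk P Q n -> exists2 m, sval P `+` sval Q #= `I_m & m <= n.
Proof.
elim: n P => [|n IH] P.
  move=> /walk0_eq ->; exists 0%N => //.
  by rewrite II0 setYK card_eq0.
move=> /walkS[R /card_eq1P[e PR] /IH[m RQm mn]].
have -> : sval P `+` sval Q = (sval R `+` sval Q) `+` [set e].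
  by rewrite -PR [RHS]setYC (setYC (sval R) (sval Q)) setY_cancel.
set D := sval R `+` sval Q in RQm *.
case: (pselect (D e)) => De.
  rewrite setY1_in//; case: m mn RQm => [|m] mn Dm.
    by move: Dm; rewrite II0 card_eq0 => /eqP D0; move: De; rewrite D0.
  exists m; first by rewrite -card_eqS_setD1.
  exact/ltnW/ltnW.
have Ee : (D `+` [set e]) e by apply/setYP => -[_ /(_ erefl)].
exists m.+1 => //; apply/eq_cardSP; exists e => //.
by rewrite -setY1_in// -setYA setYK setY0.
Qed.

(** The elements in which [P] and [Q] differ are toggled one at a time. *)
Lemma walk_hypercube X (P Q : hypercube X) n :
  sval P `+` sval Q #= `I_n -> walk P Q n.
Proof.
elim: n P => [|n IH] P.
  rewrite II0 card_eq0 => /eqP PQ0; suff -> : P = Q by exact: walk0.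
  apply: eq_sig_hprop => [A|]; first exact: Prop_irrelevance.
  rewrite -[LHS]setY0 -PQ0 setYA setYK.
  by rewrite set0Y.
move=> /eq_cardSP[e De Dn].
have fR : finite_set (sval P `+` [set e]).
  by apply: finite_setY; [exact: svalP | exact: finite_set1].
apply/walkS; exists (exist _ _ fR).
  rewrite /= /hc_adj /= setYA setYK set0Y; exact: card_set1.
apply: IH => /=; rewrite -setYA (setYC [set e]) setYA setY1_in//.
Qed.

Lemma hypercube_gdistP X (P Q : hypercube X) n :
  gdist P Q = Some n <-> sval P `+` sval Q #= `I_n.
Proof.
rewrite gdistP; split=> [[PQ nmin]|PQ].
  have [m PQm mn] := hypercube_walk PQ.
  suff -> : n = m by [].
  by apply/eqP; rewrite eqn_leq mn andbT; exact/nmin/walk_hypercube.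
split=> [|m /hypercube_walk[k PQk km]]; first exact: walk_hypercube.
by rewrite (card_II_inj PQ PQk).
Qed.

Definition cube_labelling G X (f : G -> set X) : Prop :=
  forall x y n, gdist x y = Some n -> f x `+` f y #= `I_n.

(* The labels may be infinite: only their symmetric differences must be finite,
   and adding a fixed label modulo 2 makes all of them finite. *)
Lemma partial_cubeP G :
  partial_cube G <->
  connected_graph G /\ exists X (f : G -> set X), cube_labelling f.
Proof.
split=> [[X [f fiso]]|[Gc [X [f flab]]]].
  split; last first.
    exists X, (fun x => sval (f x)) => x y n xyn.
    by apply/hypercube_gdistP; rewrite fiso.
  move=> x y; have /finite_setP[n xyn] :
      finite_set (sval (f x) `+` sval (f y)).
    by apply: finite_setY; exact: svalP.
  move: xyn => /hypercube_gdistP; rewrite fiso => /gdistP[xyn _].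
  by exists n.
have [x0] := vertex_inhabited G.
have fin x : finite_set (f x `+` f x0).
  have [n /flab xn] := connected_gdist x x0 Gc.
  by apply/finite_setP; exists n.
exists X, (fun x => exist _ _ (fin x)) => x y.
have [n xyn] := connected_gdist x y Gc.
by rewrite xyn; apply/hypercube_gdistP; rewrite /= setY_cancel; exact: flab.
Qed.

Lemma partial_cube_isometric G H (f : G -> H) :
  isometric_embedding f -> partial_cube H -> partial_cube G.
Proof.
move=> fiso [X [h hiso]]; exists X, (h \o f) => x y.
by rewrite /= hiso fiso.
Qed.

Lemma graph_iso_sym G H : graph_iso G H -> graph_iso H G.
Proof.
move=> [f [g fK gK] fadj]; exists g; first by exists f.
by move=> x y; rewrite -fadj !gK.
Qed.

Lemma partial_cube_iso G H : graph_iso G H -> partial_cube H -> partial_cube G.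
Proof.
move=> [f [g fK gK] fadj]; apply: (@partial_cube_isometric _ _ f) => x y.
apply: eq_gdist => n; split; last first.
  by apply: walk_homo => ? ?; rewrite fadj.
rewrite -{2}(fK x) -{2}(fK y); apply: walk_homo => a b.
by rewrite -{1}(gK a) -{1}(gK b) fadj.
Qed.

End Labellings.

(** * Distances in an expansion *)

Section ExpansionDistance.
Context {G : sgraph} {G1 G2 : subgraph G}.
Implicit Types u v : expansion G1 G2.

Definition exp_proj (u : expansion G1 G2) : G :=
  match u with inl x => sval x | inr x => sval x end.

Definition exp_side (u : expansion G1 G2) : bool :=
  if u is inr _ then true else false.

Lemma walk_exp_proj u v n : walk u v n ->
  exists2 m, walk (exp_proj u) (exp_proj v) m &
             m + (exp_side u (+) exp_side v) <= n.
Proof.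
elim: n u => [|n IH] u.
  by move=> /walk0_eq ->; exists 0%N; [exact: walk0 | rewrite addbb].
move=> /walkS[w uw /IH[m wv mn]].
have [pw|pq] : adj (exp_proj u) (exp_proj w) /\ exp_side u = exp_side w \/
               exp_proj u = exp_proj w.
- case: u w uw {wv mn} => [x|x] [y|y] /= => [/sg_edge_adj| /asboolP
    | /asboolP | /sg_edge_adj]; by [left | right].
- case: pw => pw ->; exists m.+1 => //.
  by apply/walkS; exists (exp_proj w).
(* A switch of side leaves the projection in place but costs one step, which pays for any change in
   the side term. *)
- rewrite pq; exists m => //.
  by case: (exp_side u) (exp_side w) (exp_side v) mn
    => [] [] [] /=; rewrite ?addn0 ?addn1// => /leqW// /ltnW.
Qed.

Lemma isometric_subgraph_walk (H : subgraph G) (a b : sub_graph H) n :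
  isometric_subgraph H -> walk (sval a) (sval b) n ->
  exists2 m, walk a b m & m <= n.
Proof.
move=> Hiso /gdist_walk[m]; rewrite -Hiso => /gdistP[abm _] mn.
by exists m.
Qed.

Lemma walk_inl (a b : sub_graph G1) n :
  walk a b n -> walk (inl a : expansion G1 G2) (inl b) n.
Proof. exact: (@walk_homo _ (expansion G1 G2) inl). Qed.

Lemma walk_inr (a b : sub_graph G2) n :
  walk a b n -> walk (inr a : expansion G1 G2) (inr b) n.
Proof. exact: (@walk_homo _ (expansion G1 G2) inr). Qed.

(** The first edge of the walk that is not in [G1] is in [G2], so its origin lies in both subgraphs.
    If there is no such edge, [y] itself lies in both. *)
Lemma cover_walk_meet (x y : G) n :
  subgraph_cover G1 G2 -> sg_vertex G1 x -> sg_vertex G2 y -> walk x y n ->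
  exists z a b, [/\ sg_vertex G1 z, sg_vertex G2 z, walk x z a, walk z y b
                  & (a + b = n)%N].
Proof.
move=> [_ cov] + y2; elim: n x => [|n IH] x x1.
  by move=> /walk0_eq xy; subst x; exists y, 0%N, 0%N; split=> //; exact: walk0.
move=> xyn; have /walkS[w xw wy] := xyn.
move: (xw); rewrite cov => /orP[/sg_edge_vertex[_ w1]|/sg_edge_vertex[x2 _]].
  have [z [a [b [z1 z2 wz zy abn]]]] := IH _ w1 wy.
  exists z, a.+1, b; split=> //; last by rewrite addSn abn.
  by apply/walkS; exists w.
by exists x, 0%N, n.+1; split=> //; exact: walk0.
Qed.

Hypotheses (iso1 : isometric_subgraph G1) (iso2 : isometric_subgraph G2).
Hypothesis cov : subgraph_cover G1 G2.

(** The walk is cut at a common vertex [z], each piece is replaced by a walk inside its subgraph of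
    at most the same length, and the switch of side at [z] costs the extra unit. *)
Lemma walk_inl_inr (x : sub_graph G1) (y : sub_graph G2) n :
  walk (sval x) (sval y) n ->
  exists2 m, walk (inl x : expansion G1 G2) (inr y) m & m <= n.+1.
Proof.
move=> /(cover_walk_meet cov (svalP x) (svalP y)).
move=> [z [a [b [z1 z2 xz zy <-]]]].
have [a' xza aa'] :=
  @isometric_subgraph_walk G1 x (exist _ z z1) a iso1 xz.
have [b' zyb bb'] :=
  @isometric_subgraph_walk G2 (exist _ z z2) y b iso2 zy.
exists (a' + b'.+1)%N; last by rewrite addnS ltnS leq_add.
apply: (walk_cat (walk_inl xza)); apply/walkS.
by exists (inr (exist _ z z2)); [exact/asboolP | exact: walk_inr].
Qed.

Lemma exp_proj_walk u v n : walk (exp_proj u) (exp_proj v) n ->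
  exists2 m, walk u v m & m <= n + (exp_side u (+) exp_side v).
Proof.
case: u v => [x|x] [y|y] /=; rewrite ?addn0 ?addn1.
- move=> /(isometric_subgraph_walk iso1)[m xy mn].
  by exists m => //; exact: walk_inl.
- exact: walk_inl_inr.
- move=> /walk_sym/walk_inl_inr[m yx mn].
  by exists m => //; exact: walk_sym.
- move=> /(isometric_subgraph_walk iso2)[m xy mn].
  by exists m => //; exact: walk_inr.
Qed.

Lemma gdist_expansion u v n : gdist (exp_proj u) (exp_proj v) = Some n ->
  gdist u v = Some (n + (exp_side u (+) exp_side v))%N.
Proof.
move=> /gdistP[/exp_proj_walk[m uvm mn] nmin].
(* Projection bounds every walk from below; the lifted walk of length [m] attains the bound. *)
have lb k : walk u v k -> n + (exp_side u (+) exp_side v) <= k.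
  move=> /walk_exp_proj[l /nmin nl]; apply: leq_trans.
  by rewrite leq_add2r.
apply/gdistP; split=> //.
by have /eqP -> : n + (exp_side u (+) exp_side v) == m by rewrite eqn_leq mn lb.
Qed.

Hypothesis Gc : connected_graph G.

Lemma connected_expansion : connected_graph (expansion G1 G2).
Proof.
by move=> u v; have [n /exp_proj_walk[m]] := Gc (exp_proj u) (exp_proj v);
  exists m.
Qed.

Lemma cover_meet : exists z, sg_vertex G1 z /\ sg_vertex G2 z.
Proof.
have [[x x1] [y y2]] := (sg_nonempty G1, sg_nonempty G2).
have [n /(cover_walk_meet cov x1 y2)[z [a [b []]]]] := Gc x y.
by exists z.
Qed.

(** * Transfer of labellings between a graph and its expansion *)

Lemma partial_cube_expansion :
  partial_cube G -> partial_cube (expansion G1 G2).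
Proof.
move=> /partial_cubeP[_ [X [f flab]]]; apply/partial_cubeP.
split; first exact: connected_expansion.
pose F u : set (option X) :=
  fun o => if o is Some x then f (exp_proj u) x else exp_side u.
exists (option X), F => u v k uvk.
have [n uvn] := connected_gdist (exp_proj u) (exp_proj v) Gc.
move: uvk; rewrite (gdist_expansion uvn) => -[<-].
have FN : (F u `+` F v) None <-> exp_side u (+) exp_side v.
  by rewrite setYP addb_iffP.
have FS x : (F u `+` F v) (Some x) <->
            (f (exp_proj u) `+` f (exp_proj v)) x by rewrite !setYP.
(* Outside [None] the labels differ as those of the projections do, in [n] elements; [None] then
   accounts for the side term. *)
have FD : (F u `+` F v) `\ None #= `I_n.
  suff -> : (F u `+` F v) `\ None =
      [set Some x | x in f (exp_proj u) `+` f (exp_proj v)].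
    by rewrite card_eq_somel; exact: flab.
  apply/seteqP; split=> [[x|] [Fx xN]|_ [x fx <-]].
  - by exists x => //; exact/FS.
  - by case: xN.
  - by split=> //; exact/FS.
case: (boolP (exp_side u (+) exp_side v)) => uv.
  by rewrite addn1 (@card_eqS_setD1 _ _ None) //; exact/FN.
rewrite addn0; suff <- : (F u `+` F v) `\ None = F u `+` F v by [].
apply: not_setD1; by move=> /FN; exact/negP.
Qed.

Lemma partial_cube_contraction :
  partial_cube (expansion G1 G2) -> partial_cube G.
Proof.
move=> /partial_cubeP[_ [X [f flab]]]; apply/partial_cubeP; split=> //.
have [z [z1 z2]] := cover_meet.
pose u1 : expansion G1 G2 := inl (exist _ z z1).
pose u2 : expansion G1 G2 := inr (exist _ z z2).
have flabE u v n : gdist (exp_proj u) (exp_proj v) = Some n ->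
    f u `+` f v #= `I_(n + (exp_side u (+) exp_side v)).
  by move=> /gdist_expansion/flab.
have zz : gdist z z = Some 0%N by apply/gdistP; split=> //; exact: walk0.
have [e f12] : exists e, f u1 `+` f u2 = [set e].
  by apply: card_eq1P; exact: (flabE u1 u2 0%N zz).
have e12 : ~ (f u1 e <-> f u2 e) by apply/setYP; rewrite f12.
(* The distances from [u] to the copies of [z] are [n] on its own side and [n + 1] on the other.
   Toggling [e] turns the smaller label difference into the larger, so [e] is not in the smaller:
   [u] agrees at [e] with the copy of [z] on its side. *)
have fe u : f u e <-> f (if exp_side u then u2 else u1) e.
  apply: contrapT; rewrite -setYP.
  have [n un] := connected_gdist (exp_proj u) z Gc.
  have un1 := flabE u u1 n un; have un2 := flabE u u2 n un.
  have f1 : f u `+` f u2 = (f u `+` f u1) `+` [set e].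
    by rewrite -f12 -setYA (setYA (f u1)) setYK set0Y.
  have f2 : f u `+` f u1 = (f u `+` f u2) `+` [set e].
    by rewrite -f12 (setYC (f u1)) -setYA (setYA (f u2)) setYK set0Y.
  case: (exp_side u) un1 un2; rewrite /= ?addn0 ?addn1 => un1 un2.
    by apply: (card_setY1_notin un2); rewrite -f2.
  by apply: (card_setY1_notin un1); rewrite -f1.
have fuv u v : (f u `+` f v) e <-> exp_side u (+) exp_side v.
  rewrite setYP (fe u) (fe v).
  by case: (exp_side u) (exp_side v) => [] [] /=; split=> //; tauto.
(* A common vertex has two lifts, and either will do: the side term that depends on this choice
   disappears with [e]. *)
have /choice[s sK] : forall x, exists u, exp_proj u = x.
  move=> x; have [x1|x2] := cov.1 x.
    by exists (inl (exist _ x x1)).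
  by exists (inr (exist _ x x2)).
exists X, (fun x => f (s x) `\ e) => x y n; rewrite -{1}(sK x) -{1}(sK y).
move=> /flabE xyn.
have -> : (f (s x) `\ e) `+` (f (s y) `\ e) = (f (s x) `+` f (s y)) `\ e.
  by rewrite !setDE setIYl.
(* If the sides differ, deleting [e] removes the extra unit; otherwise [e] is not in the difference
   and nothing changes. *)
case: (boolP (exp_side (s x) (+) exp_side (s y))) xyn => xy.
  by rewrite addn1 (@card_eqS_setD1 _ _ e) //; exact/fuv.
rewrite addn0 not_setD1//.
by move=> /fuv; exact/negP.
Qed.

End ExpansionDistance.

Theorem theorem8p3 :
  (forall G G' : sgraph,
     partial_cube G -> is_expansion G' G -> partial_cube G') /\
  (forall G G' : sgraph,
     partial_cube G' -> is_contraction G G' -> partial_cube G).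
Proof.
split=> G G' pc [Gc [G1 [G2 [iso1 iso2 cov iso]]]].
  apply: partial_cube_iso iso _; exact: partial_cube_expansion.
apply: (@partial_cube_contraction G G1 G2) => //.
exact: partial_cube_iso (graph_iso_sym iso) pc.
Qed.
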